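(* For every marked real Hadamard matrix of order $N\ge8$, with $d=N-1$ and associated Hadamard simplex $\Delta$, and for all positive odd integers $n<m<dn$, the polytope $P_{m,n}=m\Delta\cap[-n,n]^d$ is integral and normal whenever $$m\ge\frac{(d-3)n}{2}+d-1 .$$
   Context: A marked Hadamard matrix is a real Hadamard matrix $H$ of order $N$ ($N\times N$, entries $\pm1$, $HH^{\mathsf T}=NI$) with a chosen column. Multiply rows by signs so that the marked column becomes all ones, and delete it. With $d=N-1$, the remaining rows $v_0,\dots,v_{N-1}\in\{\pm1\}^d$ satisfy $v_i\cdot v_j=N\delta_{ij}-1$ and $\sum_iv_i=0$. The associated Hadamard simplex is $\Delta=\operatorname{conv}\{v_i\}=\{x\in\mathbb R^d: v_i\cdot x\ge-1\ \forall i\}$. Let $\Lambda_n=(n+2\mathbb Z)^d$. $P_{m,n}$ is integral if all its vertices lie in $\Lambda_n$. $P_{m,n}$ is normal if, for every integer $k\ge1$, every point of $kP_{m,n}\cap(kn+2\mathbb Z)^d$ is a sum of $k$ points of $P_{m,n}\cap\Lambda_n$ (equivalently, with $Q_{m,n}=(P_{m,n}+n\mathbf 1)/2$, every point of $kQ_{m,n}\cap\mathbb Z^d$ is a sum of $k$ points of $Q_{m,n}\cap\mathbb Z^d$). *)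

(* Defs.v *)
From mathcomp Require Import all_boot all_order all_algebra.
From mathcomp Require Import boolp classical_sets reals.

Set Implicit Arguments.
Unset Strict Implicit.
Unset Printing Implicit Defensive.

Import Order.TTheory GRing.Theory Num.Theory.
Local Open Scope classical_set_scope.
Local Open Scope ring_scope.

Definition is_hadamard (R : realType) (N : nat) (H : 'M[R]_N) : Prop :=
  (forall i j, H i j = 1 \/ H i j = -1) /\ H *m H^T = N%:R%:M.

(* Since H i c = 1 or -1, multiplying row i by the sign H i c turns
   column c into the all-ones column. *)
Definition normalize (R : realType) (N : nat) (c : 'I_N) (H : 'M[R]_N) :
    'M[R]_N :=
  \matrix_(i, j) (H i c * H i j).

Definition hadamard_point (R : realType) (N : nat) (H : 'M[R]_N) (c i : 'I_N) :
    'rV[R]_N.-1 :=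
  row i (col' c (normalize c H)).

Definition conv_hull (R : realType) (d N : nat) (v : 'I_N -> 'rV[R]_d) :
    set 'rV[R]_d :=
  [set x | exists w : 'I_N -> R,
     [/\ forall i, 0 <= w i, \sum_i w i = 1 & x = \sum_i w i *: v i]].

Definition hadamard_simplex (R : realType) (N : nat) (H : 'M[R]_N) (c : 'I_N) :
    set 'rV[R]_N.-1 :=
  conv_hull (hadamard_point H c).

Definition dilate (R : realType) (d : nat) (a : R) (A : set 'rV[R]_d) :
    set 'rV[R]_d :=
  [set a *: x | x in A].

Definition cube (R : realType) (d : nat) (a : R) : set 'rV[R]_d :=
  [set x | forall j, - a <= x ord0 j <= a].

Definition hadamard_polytope (R : realType) (N : nat) (H : 'M[R]_N)
    (c : 'I_N) (m n : nat) :
    set 'rV[R]_N.-1 :=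
  dilate m%:R (hadamard_simplex H c) `&` cube n%:R.

Definition lattice (R : realType) (d a : nat) : set 'rV[R]_d :=
  [set x | forall j, exists z : int, x ord0 j = a%:R + 2 * z%:~R].

(* Vertices of a polytope, as its extreme points. *)
Definition vertices (R : realType) (d : nat) (A : set 'rV[R]_d) :
    set 'rV[R]_d :=
  [set x | A x /\ forall (y z : 'rV[R]_d) (t : R), A y -> A z -> 0 < t < 1 ->
     x = t *: y + (1 - t) *: z -> y = x /\ z = x].

Definition integral_polytope (R : realType) (d n : nat) (A : set 'rV[R]_d) : Prop :=
  vertices A `<=` lattice n.

Definition normal_polytope (R : realType) (d n : nat) (A : set 'rV[R]_d) : Prop :=
  forall k : nat, (1 <= k)%N ->
  forall x, (dilate k%:R A `&` lattice (k * n)%N) x ->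
  exists p : 'I_k -> 'rV[R]_d,
    (forall i, (A `&` lattice n) (p i)) /\ x = \sum_(i < k) p i.

(* Main.v *)
Require Import Defs.
From mathcomp Require Import all_boot all_order all_algebra.
From mathcomp Require Import boolp classical_sets reals.
From mathcomp Require Import ring lra zify.

Set Implicit Arguments.
Unset Strict Implicit.
Unset Printing Implicit Defensive.

Import Order.TTheory GRing.Theory Num.Theory.
Local Open Scope ring_scope.

(** Write [v_i] for the rows of the normalised matrix without the marked
    column, so that [P] is cut out of the cube [[-n, n]^d] by the inequalities
    [v_i . x >= -m]. Substituting [x = n + 2 y] turns the lattice into [Z^d]
    and the inequalities into [t_i(y) = c_i + v_i . y >= 0], where
    [2 c_i = n V_i + m] and [V_i] is the sum of the entries of [v_i]. The
    orthogonality of the rows forces all [V_i] to agree modulo 4, hence all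
    [c_i] to have the same parity ([offsets_exist]).

    Everything follows from a rounding statement ([rounding_exists]): each real
    point [y] of the polytope has an integral point [z] of the polytope with
    [|z_j - y_j| < 1] for all [j] that lies on every facet containing [y] and
    such that [k y - z] lies in the [(k-1)]-fold dilate whenever [k >= 2] and
    [k y] is integral. Removing such a [z] again and again writes a lattice
    point of the [k]-fold dilate as a sum of [k] lattice points of the polytope
    ([sum_decomposition]). If [y] is a vertex, then [z = y], since one can
    continue the segment from [z] to [y] a little beyond [y] without leaving
    the polytope ([room_beyond]); so the vertices are lattice points.

    To find [z], look at the lattice cell whose vertices are the roundings of
    [y]. A row whose inequality holds on the whole cell imposes no condition on
    [z] ([uncut_row]). At most three rows fail somewhere on the cell
    ([at_most_three_cuts]): at the centre [u] of the cell such a row satisfies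
    [v_i . u <= -m - 2 + d], whereas four rows have sums [s_j] with
    [|s_j| <= s_j^2 / 2] (sums of four signs are even) and
    [sum_j s_j^2 = 4 d - 12] (orthogonality), so their values at [u] add up to
    at least [-(2 d - 6) n]. Together this contradicts the lower bound on [m].

    For three rows the columns fall into four classes: either all three entries
    agree, or exactly one row differs from the other two. The three values
    depend on [y] only through the four signed class sums, and a class sum can
    be rounded to either neighbouring integer by rounding the coordinates
    ([rounds_sum]). It remains to round four numbers such that three linear
    forms behave well, which is a short case analysis on the parity of the
    [c_i] ([class_sums_roundable]). *)

(** * Roundings of real numbers *)

(** For an integer [z] the condition says that [z] is the floor or the ceiling
    of [y]; unlike a formulation with floors it is invariant under sign
    changes. *)
Definition rounds (R : numDomainType) (z : int) (y : R) := `|z%:~R - y| < 1.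

Lemma rounds_sign (R : numDomainType) (b : bool) (z : int) (y : R) :
  rounds z y -> rounds ((-1) ^+ b * z) ((-1) ^+ b * y).
Proof. by rewrite /rounds rmorphM rmorph_sign -mulrBr normrMsign. Qed.

Lemma rounds_floor (R : archiRealFieldType) (z : int) (y : R) :
  rounds z y -> Num.floor y <= z.
Proof.
rewrite /rounds ltr_norml => /andP[l _].
have : (Num.floor y)%:~R < (z + 1)%:~R :> R by have := floor_le y; lra.
by rewrite ltr_int; clear; lia.
Qed.

Lemma rounds_int (R : numDomainType) (z q : int) :
  rounds z (q%:~R : R) -> z = q.
Proof.
by rewrite /rounds -intrB -intr_norm (ltr_int R _ 1); clear; lia.
Qed.

Lemma rounds_between (R : archiRealFieldType) (a b z : int) (y : R) :
  a%:~R <= y <= b%:~R -> rounds z y -> a <= z <= b.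
Proof.
rewrite /rounds ltr_norml => /andP[ay yb] /andP[l u].
have az : a < z + 1 by rewrite -(ltr_int R) intrD; lra.
have zb : z < b + 1 by rewrite -(ltr_int R) intrD; lra.
by clear -az zb; lia.
Qed.

(** The coordinates of [k y - z] stay above [k - 1] times the floor of those of
    [y]. If [z] is the floor of [y] this is clear; otherwise [y] exceeds its
    floor, so the integer [k y] is at least one more than [k] times the
    floor. *)
Lemma rounds_remainder (R : archiRealFieldType) (k : nat) (z Y : int) (y : R) :
  (0 < k)%N -> rounds z y -> Y%:~R = k%:R * y ->
  (k%:Z - 1) * Num.floor y <= Y - z.
Proof.
move=> k0 zy eY; have /andP[] := floor_itv y; set q := Num.floor y.
rewrite intrD => lq uq; rewrite mulrBl mul1r.
have k0R : 0 < k%:R :> R by rewrite ltr0n.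
move: zy; rewrite /rounds ltr_norml => /andP[lz uz].
have [zq|qz] := leP z q.
  have : (k%:Z * q)%:~R <= Y%:~R :> R by rewrite eY intrM pmulrn ler_pM2l.
  by rewrite ler_int; clear -zq; lia.
have qzR : (q + 1)%:~R <= z%:~R :> R by rewrite ler_int; clear -qz; lia.
have zq : z < q + 2 by rewrite -(ltr_int R); lra.
have : (k%:Z * q)%:~R < Y%:~R :> R.
  by rewrite eY intrM pmulrn ltr_pM2l //; lra.
by rewrite ltr_int; clear -zq; lia.
Qed.

(** Rounding one summand to the neighbour on the appropriate side keeps the
    remaining error strictly between -1 and 1, so the summands can be rounded
    one at a time. *)
Lemma rounds_sum (R : archiRealFieldType) (I : eqType) (s : seq I) (a : I -> R)
    (g : int) :
  uniq s -> rounds g (\sum_(i <- s) a i) ->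
  exists r : I -> int, (forall i, i \in s -> rounds (r i) (a i)) /\
    \sum_(i <- s) r i = g.
Proof.
elim: s g => [|i s IHs] g /=.
  move=> _; rewrite big_nil /rounds subr0 -intr_norm (ltr_int R _ 1) => g0.
  by exists (fun=> 0); split=> //; rewrite big_nil; clear -g0; lia.
rewrite big_cons => /andP[si us]; rewrite /rounds ltr_norml => /andP[lg ug].
set S := \sum_(j <- s) a j in lg ug.
have [r0 [r0a r0S]] : exists r0 : int, rounds r0 (a i) /\ rounds (g - r0) S.
  have /andP[] := floor_itv (a i); set q := Num.floor _; rewrite intrD => lq uq.
  have [small|big] := ltP (g%:~R - S - q%:~R) 1.
    by exists q; rewrite /rounds !ltr_norml !intrB; split; lra.
  by exists (q + 1); rewrite /rounds !ltr_norml !intrB !intrD; split; lra.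
have [r [ra rg]] := IHs _ us r0S.
exists (fun j => if j == i then r0 else r j); split=> [j|].
  rewrite inE; case: eqP => [->|_] //= js; exact: ra.
rewrite big_cons eqxx (eq_big_seq r) ?rg ?subrKC // => j js.
by case: eqP => // ji; rewrite -ji js in si.
Qed.

(** * Rounding the class sums of three rows *)

(** The value of the first of three rows in terms of the class sums: [g0] is the
    sum over the columns where the three rows agree, [gi] the sum over those
    where row [i] is the odd one out; the values of the other two rows arise by
    permuting [g1], [g2], [g3]. *)
Definition odd_out (V : zmodType) (g0 g1 g2 g3 : V) := g2 + g3 - g1 - g0.

(** Integers [f1], [f2], [f3] are acceptable values of three rows at a rounding
    of a point where the values are [t1], [t2], [t3]: the rounding satisfies
    the three inequalities, lies on the facets containing the point, and can be
    subtracted from the [k]-fold multiple of the point. The values [F1], [F2],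
    [F3] of the rows at a lattice point always have the same parity, so if one
    of them vanishes, the others are 0 or at least 2. *)
Definition good_values (R : numDomainType) (t1 t2 t3 : R) (f1 f2 f3 : int) :=
  [/\ [/\ 0 <= f1, 0 <= f2 & 0 <= f3],
      [/\ t1 = 0 -> f1 = 0, t2 = 0 -> f2 = 0 & t3 = 0 -> f3 = 0] &
      forall (k : nat) (F1 F2 F3 : int), (1 < k)%N ->
        F1%:~R = k%:R * t1 -> F2%:~R = k%:R * t2 -> F3%:~R = k%:R * t3 ->
        (2 %| F1 - F2)%Z -> (2 %| F1 - F3)%Z ->
        [/\ f1 <= F1, f2 <= F2 & f3 <= F3]].

Definition roundable (R : numDomainType) (c1 c2 c3 : int) (z0 z1 z2 z3 : R) :=
  exists g0 g1 g2 g3 : int,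
    [/\ rounds g0 z0, rounds g1 z1, rounds g2 z2 & rounds g3 z3] /\
    good_values (c1%:~R + odd_out z0 z1 z2 z3) (c2%:~R + odd_out z0 z2 z1 z3)
         (c3%:~R + odd_out z0 z3 z1 z2)
         (c1 + odd_out g0 g1 g2 g3) (c2 + odd_out g0 g2 g1 g3)
         (c3 + odd_out g0 g3 g1 g2).

Lemma good_valuesC12 (R : numDomainType) (t1 t2 t3 : R) f1 f2 f3 :
  good_values t1 t2 t3 f1 f2 f3 -> good_values t2 t1 t3 f2 f1 f3.
Proof.
move=> [[? ? ?] [? ? ?] ub]; split=> // k F2 F1 F3 k1 e2 e1 e3 p12 p13.
by have [] // := ub k F1 F2 F3 k1 e1 e2 e3; lia.
Qed.

Lemma good_valuesC23 (R : numDomainType) (t1 t2 t3 : R) f1 f2 f3 :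
  good_values t1 t2 t3 f1 f2 f3 -> good_values t1 t3 t2 f1 f3 f2.
Proof.
move=> [[? ? ?] [? ? ?] ub]; split=> // k F1 F3 F2 k1 e1 e3 e2 p13 p12.
by have [] // := ub k F1 F2 F3 k1 e1 e2 e3 p12 p13.
Qed.

Lemma odd_outC (V : zmodType) (g0 g1 g2 g3 : V) :
  odd_out g0 g1 g2 g3 = odd_out g0 g1 g3 g2.
Proof. by rewrite /odd_out [g2 + g3]addrC. Qed.

Lemma roundableC12 (R : numDomainType) c1 c2 c3 (z0 z1 z2 z3 : R) :
  roundable c2 c1 c3 z0 z2 z1 z3 -> roundable c1 c2 c3 z0 z1 z2 z3.
Proof.
move=> [g0 [g2 [g1 [g3 [[r0 r2 r1 r3] /good_valuesC12 h]]]]].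
exists g0, g1, g2, g3; split=> //.
by rewrite [odd_out z0 z3 _ _]odd_outC [odd_out g0 g3 _ _]odd_outC.
Qed.

Lemma roundableC23 (R : numDomainType) c1 c2 c3 (z0 z1 z2 z3 : R) :
  roundable c1 c3 c2 z0 z1 z3 z2 -> roundable c1 c2 c3 z0 z1 z2 z3.
Proof.
move=> [g0 [g1 [g3 [g2 [[r0 r1 r3 r2] /good_valuesC23 h]]]]].
exists g0, g1, g2, g3; split=> //.
by rewrite [odd_out z0 z1 _ _]odd_outC [odd_out g0 g1 _ _]odd_outC.
Qed.

(** As [t <= F / 2], an integer below [t + 2] is at most [F] once [F >= 2],
    which holds when [t >= 1] and also when [F] is even and positive; for
    [f <= 1] the positivity of [F] is enough. *)
Lemma good_value_le (R : realFieldType) (k : nat) (t : R) (f F : int) :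
    (1 < k)%N -> F%:~R = k%:R * t -> 0 <= t -> (t = 0 -> f = 0) ->
    f%:~R < t + 2 -> [\/ f <= 1, 1 <= t | (2 %| F)%Z] -> f <= F.
Proof.
move=> k1 eF; rewrite le_eqVlt => /predU1P[/esym t0 /(_ t0) -> _ _|t0 _ ft].
  by rewrite -(ler_int R) eF t0 mulr0.
have k2 : 2 <= k%:R :> R by rewrite ler_nat.
have F0 : 0 < F by rewrite -(ltr_int R) eF mulr_gt0 // ltr0n ltnW.
have bigF : 2 <= F -> f <= F.
  move=> F2; have tF : 2 * t <= F%:~R by nra.
  have : (2 * f)%:~R < (F + 4)%:~R :> R by lra.
  by rewrite ltr_int; lia.
case=> [f1|t1|F2]; [lia| |by apply: bigF; lia].
by apply: bigF; rewrite -(ler_int R) eF; nra.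
Qed.

Lemma same_parity_gt (J1 J2 a : int) :
  (2 %| J1 - J2)%Z -> (2 %| J1 - a)%Z -> a < J2 -> a + 1 < J2.
Proof. lia. Qed.

(** The next lemmas treat the fractional parts [x0, x1, x2, x3] of the class
    sums. [J1], [J2], [J3] are the values of the rows when every class sum is
    rounded down; they have the same parity and differ from the true values by
    less than 2.

    A negative value is [-1], and then the other two values are positive. If row
    1 is tight, the value 0 has to be reached: class 2 is rounded up. *)
Lemma roundable_neg_tight (R : realFieldType) (x0 x1 x2 x3 : R) (J2 J3 : int) :
  0 <= x0 < 1 -> 0 <= x1 < 1 -> 0 <= x2 < 1 -> 0 <= x3 < 1 ->
  (2 %| -1 - J2)%Z -> (2 %| -1 - J3)%Z ->
  (-1)%:~R + odd_out x0 x1 x2 x3 = 0 ->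
  0 <= J2%:~R + odd_out x0 x2 x1 x3 -> 0 <= J3%:~R + odd_out x0 x3 x1 x2 ->
  roundable (-1) J2 J3 x0 x1 x2 x3.
Proof.
rewrite /odd_out => h0 h1 h2 h3 p12 p13 t10 t2p t3p.
have J2pos : -1 + 1 < J2.
  by apply: same_parity_gt p12 _ _ => //; rewrite -(ltr_int R); lra.
have J3pos : -1 + 1 < J3.
  by apply: same_parity_gt p13 _ _ => //; rewrite -(ltr_int R); lra.
have J2R : 1 <= J2%:~R :> R by rewrite (ler_int R 1).
have J3R : 1 <= J3%:~R :> R by rewrite (ler_int R 1).
exists 0, 0, 1, 0; split; first by rewrite /rounds !ltr_norml; split; lra.
rewrite /odd_out t10; split.
- by clear -J2pos J3pos; split; lia.
- by split=> [_|e|e]; [|exfalso; lra|exfalso; lra].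
move=> k F1 F2 F3 k1; rewrite mulr0 => /eqP.
rewrite intr_eq0 => /eqP -> e2 e3 q2 q3; split=> //.
- apply: (good_value_le k1 e2) => //; [by move=> e; exfalso; lra|lra|].
  by constructor 3; clear -q2; lia.
- apply: (good_value_le k1 e3) => //; [by move=> e; exfalso; lra|lra|].
  by constructor 3; clear -q3; lia.
Qed.

(** If row 1 is not tight, rounding up both classes 2 and 3 raises its value to
    1 and leaves the other two values unchanged. *)
Lemma roundable_neg_loose (R : realFieldType) (x0 x1 x2 x3 : R) (J2 J3 : int) :
  0 <= x0 < 1 -> 0 <= x1 < 1 -> 0 <= x2 < 1 -> 0 <= x3 < 1 ->
  (2 %| -1 - J2)%Z -> (2 %| -1 - J3)%Z ->
  0 < (-1)%:~R + odd_out x0 x1 x2 x3 ->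
  0 <= J2%:~R + odd_out x0 x2 x1 x3 -> 0 <= J3%:~R + odd_out x0 x3 x1 x2 ->
  roundable (-1) J2 J3 x0 x1 x2 x3.
Proof.
rewrite /odd_out => h0 h1 h2 h3 p12 p13 t1p t2p t3p.
have J2pos : -1 + 1 < J2.
  by apply: same_parity_gt p12 _ _ => //; rewrite -(ltr_int R); lra.
have J3pos : -1 + 1 < J3.
  by apply: same_parity_gt p13 _ _ => //; rewrite -(ltr_int R); lra.
have J2R : 1 <= J2%:~R :> R by rewrite (ler_int R 1).
have J3R : 1 <= J3%:~R :> R by rewrite (ler_int R 1).
exists 0, 0, 1, 1; split; first by rewrite /rounds !ltr_norml; split; lra.
rewrite /odd_out; split.
- by clear -J2pos J3pos; split; lia.
- by split=> e; exfalso; lra.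
move=> k F1 F2 F3 k1 e1 e2 e3 q2 q3; split.
- by apply: (good_value_le k1 e1) => //;
    [lra|move=> e; exfalso; lra|lra|constructor 1; lra].
- apply: (good_value_le k1 e2) => //; [move=> e; exfalso; lra|lra|].
  have [J21|J21] := leP J2 1; first by constructor 1; clear -J21; lia.
  constructor 2; have : 2 <= J2%:~R :> R by rewrite (ler_int R 2).
  lra.
- apply: (good_value_le k1 e3) => //; [move=> e; exfalso; lra|lra|].
  have [J31|J31] := leP J3 1; first by constructor 1; clear -J31; lia.
  constructor 2; have : 2 <= J3%:~R :> R by rewrite (ler_int R 2).
  lra.
Qed.

(** A positive value of a tight row is 1. Rounding up class 0 lowers all three
    values by one; the other two then stay below the true values. *)
Lemma roundable_tight (R : realFieldType) (x0 x1 x2 x3 : R) (J1 J2 J3 : int) :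
  0 <= x0 < 1 -> 0 <= x1 < 1 -> 0 <= x2 < 1 -> 0 <= x3 < 1 ->
  0 < J1 -> 0 < J2 -> 0 < J3 -> J1%:~R + odd_out x0 x1 x2 x3 = 0 ->
  0 <= J2%:~R + odd_out x0 x2 x1 x3 -> 0 <= J3%:~R + odd_out x0 x3 x1 x2 ->
  roundable J1 J2 J3 x0 x1 x2 x3.
Proof.
rewrite /odd_out => h0 h1 h2 h3 J1p J2p J3p t10 t2p t3p.
have EJ1 : J1 = 1.
  have : J1 < 2 by rewrite -(ltr_int R); lra.
  by clear -J1p; lia.
rewrite {J1p}EJ1 in t10 *.
have J2R : 1 <= J2%:~R :> R by rewrite (ler_int R 1).
have J3R : 1 <= J3%:~R :> R by rewrite (ler_int R 1).
exists 1, 0, 0, 0; split; first by rewrite /rounds !ltr_norml; split; lra.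
rewrite /odd_out t10; split.
- by clear -J2p J3p; split; lia.
- by split=> [_|e|e]; [|exfalso; lra|exfalso; lra].
move=> k F1 F2 F3 k1; rewrite mulr0 => /eqP.
rewrite intr_eq0 => /eqP -> e2 e3 q2 q3; split=> //.
- apply: (good_value_le k1 e2) => //; [by move=> e; exfalso; lra|lra|].
  by constructor 3; clear -q2; lia.
- apply: (good_value_le k1 e3) => //; [by move=> e; exfalso; lra|lra|].
  by constructor 3; clear -q3; lia.
Qed.

(** For even values the only obstacle is the value 2 of a row whose true value
    is less than 1, as 2 may exceed a multiple of it. Rounding up classes 0 and
    1 lowers this value to 0 and leaves the others unchanged; adding the true
    values of two rows shows that no other row has the same defect. *)
Lemma roundable_far (R : realFieldType) (x0 x1 x2 x3 : R) (J1 J2 J3 : int) :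
  0 <= x0 < 1 -> 0 <= x1 < 1 -> 0 <= x2 < 1 -> 0 <= x3 < 1 ->
  (2 %| J1)%Z -> (2 %| J2)%Z -> (2 %| J3)%Z ->
  1 < J1 -> J1%:~R + odd_out x0 x1 x2 x3 < 1 ->
  0 <= J1%:~R + odd_out x0 x1 x2 x3 ->
  0 <= J2%:~R + odd_out x0 x2 x1 x3 -> 0 <= J3%:~R + odd_out x0 x3 x1 x2 ->
  roundable J1 J2 J3 x0 x1 x2 x3.
Proof.
rewrite /odd_out => h0 h1 h2 h3 p1 p2 p3 J1p t11 t1p t2p t3p.
have EJ1 : J1 = 2.
  have : J1 < 3 by rewrite -(ltr_int R); lra.
  by clear -J1p; lia.
rewrite {J1p p1}EJ1 in t11 t1p *.
have J2p : -1 < J2.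
  have: -2 < J2 by rewrite -(ltr_int R); lra.
  by clear -p2; lia.
have J3p : -1 < J3.
  have: -2 < J3 by rewrite -(ltr_int R); lra.
  by clear -p3; lia.
exists 1, 1, 0, 0; split; first by rewrite /rounds !ltr_norml; split; lra.
rewrite /odd_out; split.
- by clear -J2p J3p; split; lia.
- split=> e; first by clear; lia.
    have: J2 < 2 by rewrite -(ltr_int R); lra.
    by clear -p2 J2p; lia.
  have: J3 < 2 by rewrite -(ltr_int R); lra.
  by clear -p3 J3p; lia.
have zero (J : int) : (2 %| J)%Z -> -1 < J -> J < 2 -> J = 0 by clear; lia.
move=> k F1 F2 F3 k1 e1 e2 e3 q2 q3; split.
- by apply: (good_value_le k1 e1) => //; [lra|constructor 1; lra].
- have [J21|J21] := ltP J2 2.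
    by apply: (good_value_le k1 e2) => //; rewrite (zero J2) //;
      [lra|constructor 1].
  have J2R : 2 <= J2%:~R :> R by rewrite (ler_int R 2).
  by apply: (good_value_le k1 e2) => //;
    [move=> e; exfalso; lra|lra|constructor 2; lra].
- have [J31|J31] := ltP J3 2.
    by apply: (good_value_le k1 e3) => //; rewrite (zero J3) //;
      [lra|constructor 1].
  have J3R : 2 <= J3%:~R :> R by rewrite (ler_int R 2).
  by apply: (good_value_le k1 e3) => //;
    [move=> e; exfalso; lra|lra|constructor 2; lra].
Qed.

Lemma roundable_floor (R : realFieldType) (x0 x1 x2 x3 : R) (J1 J2 J3 : int) :
  0 <= x0 < 1 -> 0 <= x1 < 1 -> 0 <= x2 < 1 -> 0 <= x3 < 1 ->
  let ok J t := [/\ 0 <= J, t = 0 -> J = 0 & J <= 1 \/ 1 <= t] in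
  ok J1 (J1%:~R + odd_out x0 x1 x2 x3) ->
  ok J2 (J2%:~R + odd_out x0 x2 x1 x3) ->
  ok J3 (J3%:~R + odd_out x0 x3 x1 x2) ->
  0 <= J1%:~R + odd_out x0 x1 x2 x3 ->
  0 <= J2%:~R + odd_out x0 x2 x1 x3 -> 0 <= J3%:~R + odd_out x0 x3 x1 x2 ->
  roundable J1 J2 J3 x0 x1 x2 x3.
Proof.
move=> h0 h1 h2 h3 ok [a1 b1 u1] [a2 b2 u2] [a3 b3 u3] t1p t2p t3p.
exists 0, 0, 0, 0; split; first by rewrite /rounds !ltr_norml; split; lra.
have f0 : odd_out 0 0 0 0 = 0 :> int by [].
rewrite f0 !addr0; split=> // k F1 F2 F3 k1 e1 e2 e3 _ _; split.
- apply: (good_value_le k1 e1) => //; first by rewrite /odd_out; lra.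
  by case: u1; [constructor 1|constructor 2].
- apply: (good_value_le k1 e2) => //; first by rewrite /odd_out; lra.
  by case: u2; [constructor 1|constructor 2].
- apply: (good_value_le k1 e3) => //; first by rewrite /odd_out; lra.
  by case: u3; [constructor 1|constructor 2].
Qed.

(** Even values are nonnegative, so only a defect as in [roundable_far] can
    prevent rounding down. Odd values can be [-1], or 1 for a tight row; if
    neither occurs, rounding down works. *)
Lemma roundable_fractions (R : realFieldType) (x0 x1 x2 x3 : R)
    (J1 J2 J3 : int) :
  0 <= x0 < 1 -> 0 <= x1 < 1 -> 0 <= x2 < 1 -> 0 <= x3 < 1 ->
  (2 %| J1 - J2)%Z -> (2 %| J1 - J3)%Z ->
  0 <= J1%:~R + odd_out x0 x1 x2 x3 ->
  0 <= J2%:~R + odd_out x0 x2 x1 x3 -> 0 <= J3%:~R + odd_out x0 x3 x1 x2 ->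
  roundable J1 J2 J3 x0 x1 x2 x3.
Proof.
move=> h0 h1 h2 h3 p12 p13 t1p t2p t3p.
have [ev|od] := boolP (2 %| J1)%Z.
  have ev2 : (2 %| J2)%Z by clear -p12 ev; lia.
  have ev3 : (2 %| J3)%Z by clear -p13 ev; lia.
  have row (J : int) (t : R) : (2 %| J)%Z -> 0 <= t -> `|J%:~R - t| < 2 ->
      (1 < J /\ t < 1) \/ [/\ 0 <= J, t = 0 -> J = 0 & J <= 1 \/ 1 <= t].
    rewrite ltr_norml => pJ tp /andP[l u].
    have J0 : 0 <= J.
      have: -2 < J by rewrite -(ltr_int R); lra.
      by clear -pJ; lia.
    have [J1'|J1'] := ltP 1 J; last first.
      by right; split=> //; [clear -pJ J0 J1'; lia|left].
    have [t1|t1] := ltP t 1; [by left|right; split=> //; last by right].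
    by move=> t0; exfalso; lra.
  have [|[a1 b1]|ok1] := row J1 _ ev t1p.
  - by rewrite /odd_out ltr_norml; lra.
  - by apply: roundable_far.
  have [|[a2 b2]|ok2] := row J2 _ ev2 t2p.
  - by rewrite /odd_out ltr_norml; lra.
  - apply: roundableC12; apply: roundable_far => //.
    by rewrite [odd_out x0 x3 _ _]odd_outC.
  have [|[a3 b3]|ok3] := row J3 _ ev3 t3p.
  - by rewrite /odd_out ltr_norml; lra.
  - apply: roundableC23; apply: roundableC12; apply: roundable_far => //.
      by rewrite [odd_out x0 x1 _ _]odd_outC.
    by rewrite [odd_out x0 x2 _ _]odd_outC.
  by apply: roundable_floor.
have od2 : ~~ (2 %| J2)%Z by clear -p12 od; lia.
have od3 : ~~ (2 %| J3)%Z by clear -p13 od; lia.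
have low (J : int) (t : R) : ~~ (2 %| J)%Z -> 0 <= t -> `|J%:~R - t| < 2 ->
    J = -1 \/ 0 < J.
  rewrite ltr_norml => pJ tp /andP[l u].
  have: -2 < J by rewrite -(ltr_int R); lra.
  by clear -pJ; lia.
have neg y1 y2 y3 K2 K3 : 0 <= y1 < 1 -> 0 <= y2 < 1 -> 0 <= y3 < 1 ->
    ~~ (2 %| K2)%Z -> ~~ (2 %| K3)%Z -> 0 <= (-1)%:~R + odd_out x0 y1 y2 y3 ->
    0 <= K2%:~R + odd_out x0 y2 y1 y3 -> 0 <= K3%:~R + odd_out x0 y3 y1 y2 ->
    roundable (-1) K2 K3 x0 y1 y2 y3.
  move=> k1 k2 k3 q2 q3; rewrite le_eqVlt => /predU1P[/esym|] s1 s2 s3.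
    by apply: roundable_neg_tight => //; clear -q2 q3; lia.
  by apply: roundable_neg_loose => //; clear -q2 q3; lia.
have [|E1|J1p] := low J1 _ od t1p; first by rewrite /odd_out ltr_norml; lra.
  by rewrite E1 in t1p *; apply: neg.
have [|E2|J2p] := low J2 _ od2 t2p; first by rewrite /odd_out ltr_norml; lra.
  rewrite E2 in t2p *; apply: roundableC12; apply: neg => //.
  by rewrite [odd_out x0 x3 _ _]odd_outC.
have [|E3|J3p] := low J3 _ od3 t3p; first by rewrite /odd_out ltr_norml; lra.
  rewrite E3 in t3p *.
  apply: roundableC23; apply: roundableC12; apply: neg => //.
    by rewrite [odd_out x0 x1 _ _]odd_outC.
  by rewrite [odd_out x0 x2 _ _]odd_outC.
have [t10|t1n] := eqVneq (J1%:~R + odd_out x0 x1 x2 x3) 0.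
  by apply: roundable_tight.
have [t20|t2n] := eqVneq (J2%:~R + odd_out x0 x2 x1 x3) 0.
  apply: roundableC12; apply: roundable_tight => //.
  by rewrite [odd_out x0 x3 _ _]odd_outC.
have [t30|t3n] := eqVneq (J3%:~R + odd_out x0 x3 x1 x2) 0.
  apply: roundableC23; apply: roundableC12; apply: roundable_tight => //.
    by rewrite [odd_out x0 x1 _ _]odd_outC.
  by rewrite [odd_out x0 x2 _ _]odd_outC.
have row (J : int) (t : R) : ~~ (2 %| J)%Z -> 0 < J -> t != 0 ->
    J%:~R < t + 2 -> [/\ 0 <= J, t = 0 -> J = 0 & J <= 1 \/ 1 <= t].
  move=> pJ J0 /eqP tn l; split=> //; first by clear -J0; lia.
  have [J1'|J1'] := leP J 1; [by left|right].
  have: 3 <= J by clear -J1' pJ; lia.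
  rewrite -(ler_int R); lra.
apply: roundable_floor => //; apply: row => //; rewrite /odd_out; lra.
Qed.

Lemma class_sums_roundable (R : archiRealFieldType) (z0 z1 z2 z3 : R)
    (c1 c2 c3 : int) :
  (2 %| c1 - c2)%Z -> (2 %| c1 - c3)%Z ->
  0 <= c1%:~R + odd_out z0 z1 z2 z3 ->
  0 <= c2%:~R + odd_out z0 z2 z1 z3 -> 0 <= c3%:~R + odd_out z0 z3 z1 z2 ->
  roundable c1 c2 c3 z0 z1 z2 z3.
Proof.
pose q := @Num.floor R; pose x (z : R) := z - (q z)%:~R.
have x01 z : 0 <= x z < 1.
  by have := floor_itv z; rewrite intrD /x -/(q z); lra.
have fq y0 y1 y2 y3 (c : int) : c%:~R + odd_out y0 y1 y2 y3 =
    (c + odd_out (q y0) (q y1) (q y2) (q y3))%:~R +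
    odd_out (x y0) (x y1) (x y2) (x y3).
  by rewrite /odd_out /x; ring.
have fD y0 y1 y2 y3 (c e0 e1 e2 e3 : int) :
    c + odd_out (q y0 + e0) (q y1 + e1) (q y2 + e2) (q y3 + e3) =
    c + odd_out (q y0) (q y1) (q y2) (q y3) + odd_out e0 e1 e2 e3.
  by rewrite /odd_out; ring.
move=> p12 p13; rewrite (fq z0 z1) (fq z0 z2) (fq z0 z3) => t1 t2 t3.
have [||e0 [e1 [e2 [e3 [[r0 r1 r2 r3] fit]]]]] :=
    roundable_fractions (x01 z0) (x01 z1) (x01 z2) (x01 z3) _ _ t1 t2 t3.
- by rewrite /odd_out; clear -p12; lia.
- by rewrite /odd_out; clear -p13; lia.
have rD e z : rounds e (x z) -> rounds (q z + e) z.
  by rewrite /rounds intrD /x opprB addrA [e%:~R + _]addrC.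
exists (q z0 + e0), (q z1 + e1), (q z2 + e2), (q z3 + e3).
by split; [split; exact: rD|rewrite (fq z0 z1) (fq z0 z2) (fq z0 z3) !fD].
Qed.

(** * Rounding a point along three sign rows *)

Section ThreeRows.
Variables (J : finType) (e1 e2 e3 : J -> bool).

Definition sdot (V : pzRingType) (e : J -> bool) (w : J -> V) : V :=
  \sum_j (-1) ^+ e j * w j.

(** The class of a column: 0 if the three rows agree, and otherwise the number
    of the row that differs from the other two. *)
Definition odd_row (j : J) : nat :=
  (if e2 j == e3 j then e1 j != e2 j : nat
   else if e1 j == e3 j then 2 else 3)%N.

(** The sign of the majority of the three entries, reversed where they agree, so
    that row [i] has the opposite sign exactly on the classes 0 and [i]. *)
Definition class_sign (j : J) : bool :=
  if e2 j == e3 j then e2 j (+) (e1 j == e2 j) else e1 j.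

Definition class_sum (V : pzRingType) (w : J -> V) (k : nat) : V :=
  \sum_(j | odd_row j == k) (-1) ^+ class_sign j * w j.

Lemma sdot_class (V : pzRingType) (w : J -> V) :
  let g := class_sum w in
  [/\ sdot e1 w = odd_out (g 0) (g 1) (g 2) (g 3),
      sdot e2 w = odd_out (g 0) (g 2) (g 1) (g 3) &
      sdot e3 w = odd_out (g 0) (g 3) (g 1) (g 2)].
Proof.
rewrite /= /odd_out /sdot /class_sum; split.
all: rewrite ![\sum_(j | odd_row j == _) _]big_mkcond /= -!big_split /=.
all: rewrite -!sumrB; apply: eq_bigr => j _.
all: rewrite /odd_row /class_sign; case: (e1 j) (e2 j) (e3 j) => [] [] [] /=.
all: by rewrite ?expr0 ?expr1 ?mul1r ?mulN1r ?oppr0 ?addr0 ?add0r ?opprK.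
Qed.

Lemma three_rows_rounding (R : archiRealFieldType) (c1 c2 c3 : int)
    (y : J -> R) :
  (2 %| c1 - c2)%Z -> (2 %| c1 - c3)%Z ->
  0 <= c1%:~R + sdot e1 y -> 0 <= c2%:~R + sdot e2 y ->
  0 <= c3%:~R + sdot e3 y ->
  exists z : J -> int, (forall j, rounds (z j) (y j)) /\
    good_values (c1%:~R + sdot e1 y) (c2%:~R + sdot e2 y) (c3%:~R + sdot e3 y)
         (c1 + sdot e1 z) (c2 + sdot e2 z) (c3 + sdot e3 z).
Proof.
move=> p12 p13; have [-> -> ->] := sdot_class y => t1 t2 t3.
have [g0 [g1 [g2 [g3 [[r0 r1 r2 r3] fit]]]]] :=
  class_sums_roundable p12 p13 t1 t2 t3.
pose s k := [seq j <- index_enum J | odd_row j == k].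
have us k : uniq (s k) by rewrite filter_uniq // index_enum_uniq.
have cls k g : rounds g (class_sum y k) -> exists r : J -> int,
    (forall j, odd_row j = k -> rounds (r j) ((-1) ^+ class_sign j * y j)) /\
    \sum_(j | odd_row j == k) r j = g.
  rewrite /class_sum -big_filter => /(rounds_sum (us k))[r [ry rg]].
  exists r; split=> [j jk|]; last by rewrite -big_filter.
  by apply: ry; rewrite mem_filter jk eqxx mem_index_enum.
have [a0 [b0 e0']] := cls 0%N _ r0; have [a1 [b1 e1']] := cls 1%N _ r1.
have [a2 [b2 e2']] := cls 2%N _ r2; have [a3 [b3 e3']] := cls 3%N _ r3.
(* a class number is less than 4, so the default value is never used *)
pose a k := nth a0 [:: a0; a1; a2; a3] k.
pose z j := (-1) ^+ class_sign j * a (odd_row j) j.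
have zsum k : class_sum z k = \sum_(j | odd_row j == k) a k j.
  by apply: eq_bigr => j /eqP jk; rewrite /z jk signrMK.
exists z; split=> [j|]; last first.
  by have [-> -> ->] := sdot_class z; rewrite !zsum e0' e1' e2' e3'.
have ry : rounds (a (odd_row j) j) ((-1) ^+ class_sign j * y j).
  have : (odd_row j < 4)%N.
    by rewrite /odd_row; case: (e1 j) (e2 j) (e3 j) => [] [] [].
  case jk : (odd_row j) => [|[|[|[|//]]]] _ /=.
  - exact: b0.
  - exact: b1.
  - exact: b2.
  - exact: b3.
by rewrite -[y j](signrMK (class_sign j)); exact: rounds_sign.
Qed.
End ThreeRows.

Lemma intr_sdot (R : pzRingType) (J : finType) (e : J -> bool) (z : J -> int) :
  (sdot e z)%:~R = sdot e (fun j => (z j)%:~R) :> R.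
Proof.
by rewrite /sdot rmorph_sum; apply: eq_bigr => j _; rewrite rmorphM rmorph_sign.
Qed.

Lemma sdotB (R : pzRingType) (J : finType) (e : J -> bool) (w u : J -> R) :
  sdot e (fun j => w j - u j) = sdot e w - sdot e u.
Proof. by rewrite /sdot -sumrB; apply: eq_bigr => j _; rewrite mulrBr. Qed.

Lemma sdotZ (R : comPzRingType) (J : finType) (e : J -> bool) (a : R)
    (w : J -> R) :
  sdot e (fun j => a * w j) = a * sdot e w.
Proof. by rewrite /sdot mulr_sumr; apply: eq_bigr => j _; rewrite mulrCA. Qed.

(** * Rounding when at most three rows cut the cell *)

Section Rounding.
Variables (R : archiRealFieldType) (I J : finType) (e : I -> J -> bool).
Variables (c : I -> int) (y : J -> R).

(** The least value of row [i] on the lattice cell of [y]. *)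
Definition floor_value (i : I) : int :=
  c i + \sum_j Num.floor ((-1) ^+ e i j * y j).

Definition good_row (z : J -> int) (i : I) : Prop :=
  [/\ 0 <= c i + sdot (e i) z,
      (c i)%:~R + sdot (e i) y = 0 -> c i + sdot (e i) z = 0 &
      forall (k : nat) (Y : J -> int), (1 < k)%N ->
        (forall j, (Y j)%:~R = k%:R * y j) ->
        c i + sdot (e i) z <= k%:Z * c i + sdot (e i) Y].

(** If the row is nonnegative on the whole cell of [y], it vanishes at [y] only
    when [y] is integral, and then [z = y]. For the last clause, compare with
    the corner of the cell where the row is least: in every coordinate the
    contribution of [k y - z] is at least [k - 1] times that of the corner. *)
Lemma uncut_row (z : J -> int) (i : I) :
  0 <= floor_value i -> (forall j, rounds (z j) (y j)) -> good_row z i.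
Proof.
rewrite /floor_value => fi0 zy.
have szy j : rounds ((-1) ^+ e i j * z j) ((-1) ^+ e i j * y j).
  exact: rounds_sign.
split.
- apply: le_trans fi0 _; rewrite lerD2l; apply: ler_sum => j _.
  exact: rounds_floor.
- move=> t0.
  pose gap j := (-1) ^+ e i j * y j - (Num.floor ((-1) ^+ e i j * y j))%:~R.
  have gap_ge0 j : true -> 0 <= gap j by rewrite subr_ge0 floor_le.
  have gap0 : \sum_j gap j = 0.
    apply/eqP; rewrite eq_le sumr_ge0 // andbT /gap sumrB -rmorph_sum /=.
    move: fi0; rewrite -(ler_int R) intrD.
    by move: t0; rewrite /sdot; lra.
  have szE j : ((-1) ^+ e i j * z j)%:~R = (-1) ^+ e i j * y j.
    have /eqP := psumr_eq0P gap_ge0 gap0 (erefl true) (i := j).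
    rewrite subr_eq0 => /eqP yE.
    by have := szy j; rewrite yE => /rounds_int ->.
  apply/eqP; rewrite -(intr_eq0 R) -t0 intrD /sdot rmorph_sum /=.
  by apply/eqP; congr (_ + _); apply: eq_bigr => j _.
move=> k Y k1 eY.
have rem : (k%:Z - 1) * floor_value i <=
    k%:Z * c i - c i + (sdot (e i) Y - sdot (e i) z).
  rewrite /floor_value mulrDr lerD //; first by rewrite mulrBl mul1r.
  rewrite /sdot -sumrB mulr_sumr; apply: ler_sum => j _.
  apply: (rounds_remainder (ltnW k1)) => //.
  by rewrite intrM rmorph_sign eY; ring.
have : 0 <= (k%:Z - 1) * floor_value i.
  by apply: mulr_ge0 => //; clear -k1; lia.
by move: rem; clear; lia.
Qed.

Hypothesis parity : forall i l, (2 %| c i - c l)%Z.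
Hypothesis y_in : forall i, 0 <= (c i)%:~R + sdot (e i) y.

Lemma rounding_exists (i0 : I) : (#|[pred i | (floor_value i < 0)%R]| <= 3)%N ->
  exists z : J -> int, (forall j, rounds (z j) (y j)) /\ forall i, good_row z i.
Proof.
move=> D3; pose D := enum [pred i | floor_value i < 0].
pose i1 := nth i0 D 0; pose i2 := nth i0 D 1; pose i3 := nth i0 D 2.
have Dsub i : floor_value i < 0 -> [\/ i = i1, i = i2 | i = i3].
  move=> iD; have : i \in D by rewrite mem_enum inE.
  rewrite -index_mem => isz; have : (index i D < 3)%N.
    by rewrite (leq_trans isz) // -cardE.
  have := nth_index i0 (s := D) (x := i); rewrite mem_enum inE iD => /(_ isT).
  by case: (index i D) => [|[|[|//]]] <- _; constructor.
have [z [zy [[p1 p2 p3] [q1 q2 q3] ub]]] :=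
  three_rows_rounding (parity i1 i2) (parity i1 i3)
    (y_in i1) (y_in i2) (y_in i3).
have ubi (k : nat) (Y : J -> int) : (1 < k)%N ->
    (forall j, (Y j)%:~R = k%:R * y j) ->
    [/\ c i1 + sdot (e i1) z <= k%:Z * c i1 + sdot (e i1) Y,
        c i2 + sdot (e i2) z <= k%:Z * c i2 + sdot (e i2) Y &
        c i3 + sdot (e i3) z <= k%:Z * c i3 + sdot (e i3) Y].
  move=> k1 eY.
  have eF i : (k%:Z * c i + sdot (e i) Y)%:~R =
      k%:R * ((c i)%:~R + sdot (e i) y).
    rewrite intrD intrM intr_sdot mulrDr; congr (_ + _).
    by rewrite /sdot mulr_sumr; apply: eq_bigr => j _; rewrite eY; ring.
  have pF i l :
      (2 %| k%:Z * c i + sdot (e i) Y - (k%:Z * c l + sdot (e l) Y))%Z.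
    rewrite opprD addrACA -mulrBr rpredD //; first by rewrite dvdz_mull.
    rewrite /sdot -sumrB; apply: rpred_sum => j _.
    by case: (e i j) (e l j) => [] [] /=; rewrite ?expr0 ?expr1; clear; lia.
  exact: ub k1 (eF _) (eF _) (eF _) (pF _ _) (pF _ _).
(* [i1], [i2], [i3] may coincide *)
exists z; split=> // i.
have [/Dsub iD|/uncut_row] := ltP (floor_value i) 0; last exact.
by case: iD => ->; split=> // k Y k1 /(ubi k Y k1) [].
Qed.

End Rounding.

(** * Nearly orthogonal sign rows *)

(** A sum [s] of four signs is even, so [|s| <= s^2 / 2]. *)
Lemma four_signs (b0 b1 b2 b3 : bool) (n x : int) :
  let s : int := (-1) ^+ b0 + (-1) ^+ b1 + ((-1) ^+ b2 + (-1) ^+ b3) in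
  - n <= x <= n -> - (n * s ^+ 2) <= 2 * (s * x).
Proof.
move=> s; rewrite expr2 {}/s; case: b0 b1 b2 b3 => [] [] [] [] /=.
all: by rewrite ?expr0 ?expr1; clear; lia.
Qed.

Section SignRows.
Variables (I J : finType) (e : I -> J -> bool).
(* Rows of a normalised Hadamard matrix whose marked column, which contributes
   1 to every inner product, has been deleted. *)
Hypothesis dot_rows : forall i l, i != l ->
  \sum_j (-1) ^+ e i j * (-1) ^+ e l j = -1 :> int.

Definition row_sum (i : I) : int := \sum_j (-1) ^+ e i j.

Lemma sum_ones : \sum_(j : J) 1 = #|J|%:Z.
Proof. by rewrite sumr_const -natz. Qed.

(** For the rows [a] and [b] the number equals [sum_j (1 - a_j) (1 - b_j)], and
    each summand is 0 or 4. *)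
Lemma row_sumD (i l : I) : i != l ->
  (4 %| #|J|%:Z - 1 - (row_sum i + row_sum l))%Z.
Proof.
move=> il; have -> : #|J|%:Z - 1 - (row_sum i + row_sum l) =
    \sum_j (1 - (-1) ^+ e i j) * (1 - (-1) ^+ e l j).
  under eq_bigr => j _ do rewrite mulrBr mulr1 mulrBl mul1r opprB.
  by rewrite !(big_split, sumrB) /= (dot_rows il) sum_ones /row_sum !sumrN
    opprD addrACA.
by apply: rpred_sum => j _; case: (e i j) (e l j) => [] [].
Qed.

Lemma row_sum_parity (i : I) : (2 %| #|J|%:Z - row_sum i)%Z.
Proof.
rewrite -sum_ones -sumrB; apply: rpred_sum => j _.
by case: (e i j).
Qed.

(** Compare both rows with a third one. *)
Lemma row_sum_mod4 (i l : I) : (2 < #|I|)%N -> (4 %| row_sum i - row_sum l)%Z.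
Proof.
move=> I3; have [k ki kl] : exists2 k, k != i & k != l.
  have : (0 < #|~: [set i; l]|)%N.
    rewrite cardsCs finset.setCK cards2 subn_gt0.
    by case: (i != l) => //=; exact: ltnW.
  by case/card_gt0P => k; rewrite !inE negb_or => /andP[ki kl]; exists k.
have := row_sumD ki; have := row_sumD kl.
clear; lia.
Qed.

(** All row sums are odd: they have the parity of [#|J|], and twice a row sum is
    [#|J| - 1] modulo 4. *)
Lemma offsets_exist (n m : int) :
  (2 < #|I|)%N -> ~~ (2 %| n)%Z -> ~~ (2 %| m)%Z ->
  exists c : I -> int, (forall i, 2 * c i = n * row_sum i + m) /\
    forall i l, (2 %| c i - c l)%Z.
Proof.
move=> I3 on om; exists (fun i => ((n * row_sum i + m) %/ 2)%Z).
have odV i : ~~ (2 %| row_sum i)%Z.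
  have [l il] : exists l, i != l.
    have : (0 < #|~: [set i]|)%N.
      by rewrite cardsCs finset.setCK cards1 subn_gt0 ltnW.
    by case/card_gt0P => l; rewrite !inE eq_sym; exists l.
  have := row_sumD il; have := row_sum_mod4 i l I3; have := row_sum_parity i.
  clear; lia.
have eqc i : 2 * ((n * row_sum i + m) %/ 2)%Z = n * row_sum i + m.
  have : ~~ (2 %| n * row_sum i)%Z.
    by rewrite dvdzE abszM Euclid_dvdM // negb_or on odV.
  by clear -om; lia.
split=> // i l.
have /dvdzP[w ew] := row_sum_mod4 i l I3.
have : n * row_sum i - n * row_sum l = 4 * (n * w) by rewrite -mulrBr ew; ring.
have := eqc i; have := eqc l; clear; lia.
Qed.

(** The lower bound on [m] is exactly what excludes four cut rows: at the centre
    of the cell each of them would have a value of at most [#|J| - m - 2] in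
    the coordinates [n + 2 y], while [four_signs] bounds the sum of the four
    values from below. *)
Lemma at_most_three_cuts (R : archiRealFieldType) (c : I -> int) (m n : int)
    (y : J -> R) :
  (forall i, 2 * c i = n * row_sum i + m) ->
  (forall j, - n%:~R <= y j <= 0) ->
  (#|J|%:Z - 3) * n + 2 * #|J|%:Z - 2 <= 2 * m ->
  (#|[pred i | (floor_value e c y i < 0)%R]| <= 3)%N.
Proof.
move=> c2 y_in nm; rewrite leqNgt; apply/negP => /card_geqP[D [uD sD DS]].
have [i0 [i1 [i2 [i3 [D4 cut]]]]] : exists i0 i1 i2 i3 : I,
    uniq [:: i0; i1; i2; i3] /\
    {in [:: i0; i1; i2; i3], forall i, floor_value e c y i < 0}.
  case: D uD sD DS => [|i0 [|i1 [|i2 [|i3 [|]]]]] // uD _ DS.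
  by exists i0, i1, i2, i3; split=> // i /DS.
(* the centre of the cell, in the coordinates [n + 2 y] *)
pose C j : int := Num.floor (y j) - Num.floor (- y j) + n.
have C_in j : - n <= C j <= n.
  have /andP[ly uy] := y_in j.
  have a : - n <= Num.floor (y j) by rewrite floor_ge_int rmorphN.
  have b : Num.floor (y j) <= 0 by rewrite floor_le0; lra.
  have a' : 0 <= Num.floor (- y j) by rewrite floor_ge0; lra.
  have b' : Num.floor (- y j) <= n.
    by rewrite -(ler_int R); apply: le_trans (floor_le _) _; lra.
  by rewrite /C; clear -a b a' b'; lia.
have row i : i \in [:: i0; i1; i2; i3] ->
    \sum_j (-1) ^+ e i j * C j <= #|J|%:Z - m - 2.
  move=> /cut; rewrite /floor_value => ci.
  have : \sum_j (-1) ^+ e i j * C j <=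
      \sum_j (2 * Num.floor ((-1) ^+ e i j * y j) + 1 + n * (-1) ^+ e i j).
    apply: ler_sum => j _; rewrite /C.
    have : 0 < Num.floor (y j) + 1 + (Num.floor (- y j) + 1).
      rewrite -(ltr_int R) intrD; have := floorD1_gt (y j).
      by have := floorD1_gt (- y j); lra.
    case: (e i j) => /=; rewrite !(expr0, expr1, mulN1r, mul1r);
      by move: (Num.floor (y j)) (Num.floor (- y j)) => f g; clear; lia.
  rewrite !big_split /= -!mulr_sumr sum_ones.
  have lin (S A V ci' : int) : 2 * ci' = n * V + m -> ci' + A < 0 ->
      S <= 2 * A + #|J|%:Z + n * V -> S <= #|J|%:Z - m - 2 by clear; lia.
  exact: lin (c2 i) ci.
pose a k j : int := (-1) ^+ e k j.
pose s j : int := a i0 j + a i1 j + (a i2 j + a i3 j).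
have sq : \sum_j s j ^+ 2 = 4 * #|J|%:Z - 12.
  under eq_bigr => j _.
    have -> : s j ^+ 2 = 4 * 1 +
        2 * (a i0 j * a i1 j + a i0 j * a i2 j + a i0 j * a i3 j
             + a i1 j * a i2 j + a i1 j * a i3 j + a i2 j * a i3 j).
      rewrite /s /a.
      by case: (e i0 j) (e i1 j) (e i2 j) (e i3 j) => [] [] [] [].
    over.
  move: D4; rewrite /= !inE !negb_or -!andbA =>
    /and4P[n01 n02 n03 /and4P[n12 n13 n23 _]].
  by rewrite big_split /= -!mulr_sumr sum_ones !big_split /= !dot_rows.
have : \sum_j - (n * s j ^+ 2) <= \sum_j 2 * (s j * C j).
  by apply: ler_sum => j _; exact: four_signs (C_in j).
rewrite sumrN -!mulr_sumr sq.
have -> : \sum_j s j * C j = \sum_j a i0 j * C j + \sum_j a i1 j * C j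
    + (\sum_j a i2 j * C j + \sum_j a i3 j * C j).
  by rewrite -!big_split; apply: eq_bigr => j _; rewrite /s !mulrDl.
have := row i0; have := row i1; have := row i2; have := row i3.
rewrite /a !inE !eqxx !orbT => /(_ isT) r3 /(_ isT) r2 /(_ isT) r1 /(_ isT) r0.
have lin (S0 S1 S2 S3 k : int) : (k - 3) * n + 2 * k - 2 <= 2 * m ->
    S0 <= k - m - 2 -> S1 <= k - m - 2 -> S2 <= k - m - 2 -> S3 <= k - m - 2 ->
    - (n * (4 * k - 12)) <= 2 * (S0 + S1 + (S2 + S3)) -> False by clear; lia.
exact: lin nm r0 r1 r2 r3.
Qed.
End SignRows.

(** * Decomposition of lattice points and extreme points *)

Section Decomposition.
Variables (R : archiRealFieldType) (I J : finType) (e : I -> J -> bool).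
Variables (c : I -> int) (n : int).

Hypothesis round : forall y : J -> R,
  (forall j, - n%:~R <= y j <= 0) ->
  (forall i, 0 <= (c i)%:~R + sdot (e i) y) ->
  exists z, (forall j, rounds (z j) (y j)) /\ forall i, good_row e c y z i.

(** A rounding of [Y / k] is one summand, and the rest lies in the [k - 1]-fold
    dilate by the last clause of [good_row]. *)
Lemma sum_decomposition (k : nat) (Y : J -> int) : (0 < k)%N ->
  (forall j, - (k%:Z * n) <= Y j <= 0) ->
  (forall i, 0 <= k%:Z * c i + sdot (e i) Y) ->
  exists Z : 'I_k -> J -> int,
    [/\ forall a j, - n <= Z a j <= 0,
        forall a i, 0 <= c i + sdot (e i) (Z a) &
        forall j, Y j = \sum_a Z a j].
Proof.
elim: k Y => // -[|k] IHk Y _ boxY rowY.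
  exists (fun=> Y); split=> [a j|a i|j]; last by rewrite big_ord1.
    by have := boxY j; rewrite mul1r.
  by have := rowY i; rewrite mul1r.
have k0 : 0 < k.+2%:R :> R by rewrite ltr0n.
pose y j : R := (Y j)%:~R / k.+2%:R.
have eY j : (Y j)%:~R = k.+2%:R * y j by rewrite /y mulrC divfK // gt_eqF.
have ybox j : - n%:~R <= y j <= 0.
  have /andP[l u] := boxY j; rewrite -(ler_int R) rmorphN rmorphM /= eY in l.
  rewrite -(lerz0 R) eY pmulr_rle0 // in u.
  by rewrite u andbT -(ler_pM2l k0) mulrN.
have yrow i : 0 <= (c i)%:~R + sdot (e i) y.
  have -> : sdot (e i) y = (sdot (e i) Y)%:~R / k.+2%:R.
    rewrite intr_sdot mulrC -sdotZ; apply: eq_bigr => j _.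
    by rewrite /y [_ / _]mulrC.
  by rewrite -(pmulr_rge0 _ k0) mulrDr mulrCA divff ?gt_eqF // mulr1
    -[k.+2%:R]/(k.+2%:~R) -intrM -intrD ler0z.
have [z [zy fit]] := round ybox yrow.
have yge j : - n <= Num.floor (y j).
  by rewrite floor_ge_int rmorphN; case/andP: (ybox j).
have yle j : 0 <= Num.floor (- y j).
  by rewrite floor_ge0 oppr_ge0; case/andP: (ybox j).
have zN j : rounds (- z j) (- y j).
  by have := rounds_sign true (zy j); rewrite !mulN1r.
have zbox j : - n <= z j <= 0.
  by apply: rounds_between (zy j); rewrite rmorphN.
have boxYz j : - (k.+1%:Z * n) <= Y j - z j <= 0.
  have eYN : (- Y j)%:~R = k.+2%:R * - y j by rewrite intrN eY mulrN.
  have k1 : k.+2%:Z - 1 = k.+1%:Z by rewrite -[k.+2]addn1 PoszD addrK.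
  have := rounds_remainder (ltn0Sn _) (zy j) (eY j).
  have := rounds_remainder (ltn0Sn _) (zN j) eYN.
  rewrite k1 => up low; apply/andP; split.
    by apply: le_trans low; rewrite -mulrN ler_wpM2l.
  rewrite -oppr_ge0 opprB addrC -[z j]opprK; apply: le_trans up.
  by rewrite mulr_ge0.
have [|Z [Zbox Zrow Zsum]] := IHk (fun j => Y j - z j) isT boxYz.
- move=> i; have [_ _ /(_ k.+2 Y isT eY)] := fit i.
  rewrite sdotB; move: (sdot (e i) z) (sdot (e i) Y) (c i) => a b c'.
  by rewrite -[k.+2]addn1 PoszD; clear; lia.
exists (fun a => if unlift ord0 a is Some b then Z b else z).
split=> [a j|a i|j].
- by case: (unlift ord0 a) => [b|].
- by case: (unlift ord0 a) => [b|] //; case: (fit i).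
- rewrite big_ord_recl unlift_none; under eq_bigr do rewrite liftK.
  by rewrite -Zsum subrKC.
Qed.
End Decomposition.

(** Read [g] and [h] as the values of finitely many affine inequalities at two
    points of a polyhedron, the second of which satisfies every equality that
    the first one does: then the segment from the second point to the first
    can be prolonged beyond the first inside the polyhedron. *)
Lemma room_beyond (R : realFieldType) (K : finType) (g h : K -> R) :
  (forall k, 0 <= g k) -> (forall k, g k = 0 -> h k = 0) ->
  exists2 t : R, 0 < t & forall k, t * (h k - g k) <= g k.
Proof.
move=> g0 gh; pose S := \sum_k `|h k - g k| / g k.
have term0 k : 0 <= `|h k - g k| / g k by rewrite divr_ge0.
have S0 : 0 <= S by rewrite sumr_ge0.
exists (1 + S)^-1; first by rewrite invr_gt0; lra.
move=> k; rewrite mulrC ler_pdivrMr; last by lra.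
have [gk0|gk] := eqVneq (g k) 0; first by rewrite gk0 gh // subr0 mul0r.
apply: le_trans (ler_norm _) _; rewrite mulrC -ler_pdivrMr ?lt_def ?gk ?g0 //.
have : `|h k - g k| / g k <= S by rewrite /S (bigD1 k) //= lerDl sumr_ge0.
lra.
Qed.

(** * Inequalities of the Hadamard polytope *)

Local Open Scope classical_set_scope.

Section Hadamard.
Variables (R : realType) (N : nat) (H : 'M[R]_N) (mk : 'I_N).
Hypothesis Hhad : is_hadamard H.

Definition minus_at (i : 'I_N) (j : 'I_N.-1) : bool :=
  hadamard_point H mk i ord0 j < 0.

Let point_entry i j : hadamard_point H mk i ord0 j = H i mk * H i (lift mk j).
Proof. by rewrite !mxE. Qed.

Let sqr_entry i j : H i j * H i j = 1.
Proof. by case: (Hhad.1 i j) => ->; rewrite ?mulr1 ?mulrNN ?mulr1. Qed.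

Lemma point_sign i j : hadamard_point H mk i ord0 j = (-1) ^+ minus_at i j.
Proof.
rewrite /minus_at point_entry.
case: (Hhad.1 i mk) (Hhad.1 i (lift mk j)) => -> [] ->;
  by rewrite ?mulrNN ?mulr1 ?mul1r ?ltr10 ?oppr_lt0 ?ltr01 ?expr0 ?expr1.
Qed.

Let N_neq0 : N%:R != 0 :> R.
Proof. by rewrite pnatr_eq0 -lt0n; case: N mk => // -[]. Qed.

Let dot_entries i l : \sum_j H i j * H l j = N%:R *+ (i == l).
Proof.
have /matrixP/(_ i l) := Hhad.2; rewrite !mxE => <-.
by apply: eq_bigr => j _; rewrite mxE.
Qed.

Let dot_columns j j' : \sum_i H i j * H i j' = N%:R *+ (j == j').
Proof.
have : (N%:R^-1 *: H^T) *m H = 1%:M.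
  apply: mulmx1C.
  by rewrite -scalemxAr Hhad.2 -scalemx1 scalerA mulVf // scale1r.
move=> /matrixP/(_ j j'); rewrite -scalemxAl !mxE => /(congr1 ( *%R N%:R)).
rewrite mulrA divff // mul1r mulr_natr -mulrnA mulnC mulrnA => <-.
by apply: eq_bigr => i _; rewrite mxE.
Qed.

Lemma dot_points i l :
  \sum_j (-1) ^+ minus_at i j * (-1) ^+ minus_at l j
    = N%:R *+ (i == l) - 1 :> R.
Proof.
have := dot_entries i l; rewrite (bigD1_ord mk) //= => /(canRL (addKr _)) E.
under eq_bigr => j _ do rewrite -!point_sign !point_entry mulrACA.
rewrite -mulr_sumr E mulrDr mulrN mulrACA !sqr_entry mulr1 addrC.
by case: eqVneq => [->|_] /=; rewrite ?sqr_entry ?mul1r ?mulr0.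
Qed.

Lemma dot_columns_points j j' :
  \sum_i (-1) ^+ minus_at i j * (-1) ^+ minus_at i j' = N%:R *+ (j == j') :> R.
Proof.
rewrite -(inj_eq (@lift_inj _ mk)) -dot_columns; apply: eq_bigr => i _.
by rewrite -!point_sign !point_entry mulrACA sqr_entry mul1r.
Qed.

Lemma sum_column j : \sum_i (-1) ^+ minus_at i j = 0 :> R.
Proof.
have := dot_columns mk (lift mk j).
rewrite (negbTE (neq_lift _ _)) /= mulr0n => E; rewrite -[RHS]E.
by apply: eq_bigr => i _; rewrite -point_sign point_entry.
Qed.

Lemma dot_minus_rows i l : i != l ->
  \sum_j (-1) ^+ minus_at i j * (-1) ^+ minus_at l j = -1 :> int.
Proof.
move=> il; apply: (@intr_inj R); rewrite rmorph_sum rmorphN1 /=.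
under eq_bigr => j _ do rewrite rmorphM !rmorph_sign.
by rewrite dot_points (negbTE il) add0r.
Qed.

(** The points are dual to themselves: their inner products are [N - 1] and
    [-1], which gives the inequalities, and conversely [(1 + v_i . x) / N] are
    barycentric coordinates of [x] by the orthogonality of the columns. *)
Lemma simplexP (x : 'rV[R]_N.-1) :
  hadamard_simplex H mk x <-> forall i, -1 <= sdot (minus_at i) (x ord0).
Proof.
have N0 : 0 < N%:R :> R by rewrite lt_def N_neq0 ler0n.
split=> [[w [w0 w1 ->]] l|rows].
  have -> : sdot (minus_at l) ((\sum_i w i *: hadamard_point H mk i) ord0) =
      \sum_i w i * (N%:R *+ (l == i) - 1).
    rewrite /sdot; under eq_bigr => j _ do rewrite summxE mulr_sumr.
    rewrite exchange_big; apply: eq_bigr => i _.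
    rewrite -dot_points mulr_sumr; apply: eq_bigr => j _.
    by rewrite mxE point_sign mulrCA.
  under eq_bigr => i _ do rewrite mulrBr mulr1.
  rewrite sumrB w1 lerDr sumr_ge0 // => i _.
  by rewrite mulr_ge0 // mulrn_wge0 // ler0n.
exists (fun i => (1 + sdot (minus_at i) (x ord0)) / N%:R); split.
- by move=> i; rewrite divr_ge0 ?ler0n // addrC -lerBlDr sub0r.
- rewrite -mulr_suml big_split /= sumr_const card_ord exchange_big /=.
  rewrite big1 => [|j _].
    by rewrite addr0 divff.
  by rewrite -mulr_suml sum_column mul0r.
apply/rowP => j; rewrite summxE.
under eq_bigr => i _ do rewrite mxE point_sign mulrAC mulrC mulrDl mul1r.
rewrite -mulr_sumr big_split /= sum_column add0r.
under eq_bigr => i _ do rewrite /sdot mulr_suml.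
rewrite exchange_big /=.
have inner j' : \sum_i (-1) ^+ minus_at i j' * x ord0 j' * (-1) ^+ minus_at i j
    = x ord0 j' * (N%:R *+ (j' == j)).
  rewrite mulrC -dot_columns_points mulr_suml.
  by apply: eq_bigr => i _; rewrite mulrAC.
rewrite (eq_bigr _ (fun j' _ => inner j')) (bigD1 j) //= eqxx big1 ?addr0.
  by rewrite mulrCA mulVf // mulr1.
by move=> j' /negbTE ->; rewrite mulr0n mulr0.
Qed.

Lemma polytopeP (m n : nat) (x : 'rV[R]_N.-1) : (0 < m)%N ->
  hadamard_polytope H mk m n x <->
  (forall j, - n%:R <= x ord0 j <= n%:R) /\
  (forall i, - m%:R <= sdot (minus_at i) (x ord0)).
Proof.
move=> m0; have m0R : 0 < m%:R :> R by rewrite ltr0n.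
have scale (a : R) (u : 'rV[R]_N.-1) i :
    sdot (minus_at i) ((a *: u) ord0) = a * sdot (minus_at i) (u ord0).
  by rewrite -sdotZ; apply: eq_bigr => j _; rewrite mxE.
split=> [[[u /simplexP uP <-] box]|[box rows]]; split=> //.
  by move=> i; rewrite scale -[- _]mulrN1 ler_pM2l.
exists (m%:R^-1 *: x); last by rewrite scalerA divff ?gt_eqF // scale1r.
by apply/simplexP => i; rewrite scale mulrC ler_pdivlMr // mulN1r.
Qed.

End Hadamard.

(** * Integrality and normality *)

(** The change of coordinates [x = a n + 2 y], with the dilation factor [a]. *)
Lemma sdot_shift (R : comPzRingType) (I J : finType) (e : I -> J -> bool)
    (c : I -> int) (m n : nat) (a : R) (x y : J -> R) (i : I) :
  2 * c i = n%:Z * row_sum e i + m%:Z ->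
  (forall j, x j = a * n%:R + 2 * y j) ->
  sdot (e i) x + a * m%:R = 2 * (a * (c i)%:~R + sdot (e i) y).
Proof.
move=> ci xy.
have -> : sdot (e i) x = a * (n%:R * (row_sum e i)%:~R) + 2 * sdot (e i) y.
  rewrite /sdot /row_sum rmorph_sum !mulr_sumr -big_split.
  apply: eq_bigr => j _.
  by rewrite xy /= rmorph_sign; ring.
have : 2 * (c i)%:~R = n%:R * (row_sum e i)%:~R + m%:R :> R.
  by have /(congr1 (fun z : int => z%:~R : R)) := ci; rewrite intrD !intrM.
by move=> E; rewrite mulrDr [2 * (a * _)]mulrCA E; ring.
Qed.

Section Polytope.
Variables (R : realType) (N : nat) (H : 'M[R]_N) (mk : 'I_N) (m n : nat).
Hypotheses (Hhad : is_hadamard H) (m_gt0 : (0 < m)%N).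
Local Notation d := (N.-1).
Local Notation e := (minus_at H mk).
Local Notation P := (hadamard_polytope H mk m n).

Variable off : 'I_N -> int.
Hypothesis off2 : forall i, 2 * off i = n%:Z * row_sum e i + m%:Z.
Hypothesis round : forall y : 'I_d -> R,
  (forall j, - n%:Z%:~R <= y j <= 0) ->
  (forall i, 0 <= (off i)%:~R + sdot (e i) y) ->
  exists z, (forall j, rounds (z j) (y j)) /\ forall i, good_row e off y z i.

Let inP x : P x <-> _ := polytopeP mk Hhad n x m_gt0.

Lemma vertices_in_lattice : integral_polytope n P.
Proof.
move=> x [xP ext].
have [xbox xrow] := (inP x).1 xP.
pose y j : R := (x ord0 j - n%:R) / 2.
have xy j : x ord0 j = 1 * n%:R + 2 * y j by rewrite /y; lra.
have ybox j : - n%:Z%:~R <= y j <= 0.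
  by have := xbox j; rewrite -pmulrn /y; lra.
have val i := sdot_shift (off2 i) xy.
have [|z [zy fit]] := round ybox.
  by move=> i; have := val i; have := xrow i; rewrite !mul1r; lra.
(* the rounding, a lattice point of the smallest face containing [x] *)
pose p : 'rV[R]_d := \row_j (n%:R + 2 * (z j)%:~R).
have pz j : p ord0 j = 1 * n%:R + 2 * (z j)%:~R by rewrite mxE mul1r.
have pval i := sdot_shift (off2 i) pz.
have zbox j : - n%:R <= ((z j)%:~R : R) <= 0.
  have := rounds_between (b := 0) (a := - n%:Z) _ (zy j); rewrite rmorphN.
  by move=> /(_ (ybox j)); rewrite -(ler_int R) -(lerz0 R) rmorphN /= -?pmulrn.
have pP : P p.
  apply/inP; split=> [j|i]; first by rewrite pz; have := zbox j; lra.
  have [f0 _ _] := fit i; move: f0; rewrite -(ler_int R) intrD intr_sdot.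
  by have := pval i; lra.
pose g (k : 'I_N + ('I_d + 'I_d)) (u : 'rV[R]_d) : R :=
  match k with
  | inl i => sdot (e i) (u ord0) + m%:R
  | inr (inl j) => n%:R - u ord0 j
  | inr (inr j) => n%:R + u ord0 j
  end.
have gP u : (forall k, 0 <= g k u) <-> P u.
  rewrite inP; split=> [gu|[ubox urow] [i|[j|j]] /=].
  - split=> [j|i]; last by have /= := gu (inl i); lra.
    by have /= := gu (inr (inl j)); have /= := gu (inr (inr j)); lra.
  - by have := urow i; lra.
  - by have := ubox j; lra.
  - by have := ubox j; lra.
have tight k : g k x = 0 -> g k p = 0.
  case: k => [i|[j|j]] /= g0.
  - have [_ f0 _] := fit i.
    have /f0 : (off i)%:~R + sdot (e i) y = 0.
      by have := val i; rewrite !mul1r; lra.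
    move=> /(congr1 (fun z : int => z%:~R : R)); rewrite intrD intr_sdot.
    by have := pval i; lra.
  - have y0 : y j = 0%:~R by rewrite /y; lra.
    by have := zy j; rewrite y0 pz => /rounds_int ->; lra.
  - have yn : y j = (- n%:Z)%:~R by rewrite /y rmorphN /= -pmulrn; lra.
    have := zy j; rewrite yn pz => /rounds_int ->.
    by rewrite rmorphN /= -pmulrn; lra.
have [t t0 tg] := room_beyond ((gP x).2 xP) tight.
(* the point [x] lies strictly between [p] and [q] *)
pose q := x + t *: (x - p).
have qj j : q ord0 j = x ord0 j + t * (x ord0 j - p ord0 j) by rewrite !mxE.
have qP : P q.
  apply/gP => k.
  have -> : g k q = g k x - t * (g k p - g k x); last by have := tg k; lra.
  case: k => [i|[j|j]] /=; last first.
  - by rewrite qj; ring.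
  - by rewrite qj; ring.
  rewrite opprD addrACA subrr addr0 -sdotB -sdotZ.
  rewrite /sdot addrAC -sumrB; congr (_ + _); apply: eq_bigr => j _.
  by rewrite qj; move: ((-1) ^+ _) (x ord0 j) (p ord0 j) => s a b; ring.
have t1 : 0 < 1 + t by lra.
have [||px _] := ext p q (t / (1 + t)) pP qP.
- by rewrite divr_gt0 //= ltr_pdivrMr //; lra.
- have -> : 1 - t / (1 + t) = (1 + t)^-1 by field; lra.
  by apply/rowP => j; rewrite !mxE; field; lra.
by move=> j; exists (z j); rewrite -px pz mul1r.
Qed.

Lemma lattice_points_decompose : normal_polytope n P.
Proof.
move=> k k0 x [[u uP ux] xlat].
have [ubox urow] := (inP u).1 uP.
have /choice[Y eY] := xlat.
have kR : 0 < k%:R :> R by rewrite ltr0n.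
have xY j : x ord0 j = k%:R * n%:R + 2 * (Y j)%:~R by rewrite eY natrM.
have xu j : x ord0 j = k%:R * u ord0 j by rewrite -ux mxE.
have [|j|i|Z [Zbox Zrow Zsum]] := @sum_decomposition R _ _ e off n%:Z round k Y.
- exact: k0.
- have /andP[lu uu] := ubox j; have := xY j; rewrite xu => Yj.
  by apply/andP; split; rewrite -(ler_int R) ?rmorphN ?rmorphM /= -?pmulrn; nra.
- rewrite -(ler0z R) intrD intrM intr_sdot -pmulrn.
  have := sdot_shift (off2 i) xY; have := urow i.
  have -> : sdot (e i) (x ord0) = k%:R * sdot (e i) (u ord0).
    by rewrite -sdotZ; apply: eq_bigr => j _; rewrite xu.
  nra.
exists (fun a => \row_j (n%:R + 2 * (Z a j)%:~R)); split=> [a|].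
  have pz j : (\row_j (n%:R + 2 * (Z a j)%:~R) : 'rV[R]_d) ord0 j =
      1 * n%:R + 2 * (Z a j)%:~R.
    by rewrite mxE mul1r.
  split; last by move=> j; exists (Z a j); rewrite pz mul1r.
  apply/inP; split=> [j|i].
    have /andP[low up] := Zbox a j.
    rewrite -(ler_int R) rmorphN /= -?pmulrn in low.
    by rewrite pz; rewrite -(lerz0 R) in up; lra.
  have := Zrow a i; rewrite -(ler0z R) intrD intr_sdot.
  by have := sdot_shift (off2 i) pz; lra.
apply/rowP => j; rewrite summxE; under eq_bigr do rewrite mxE.
rewrite big_split /= sumr_const card_ord -mulr_sumr -rmorph_sum /= -Zsum.
by rewrite [LHS]xY mulr_natl.
Qed.

End Polytope.

Theorem theorem4p6 (R : realType) (N : nat) (H : 'M[R]_N) (c : 'I_N)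
    (m n : nat) :
  (8 <= N)%N -> is_hadamard H ->
  let d := N.-1 in
  (0 < n)%N -> odd n -> odd m -> (n < m)%N -> (m < d * n)%N ->
  (d%:R - 3) * n%:R / 2 + d%:R - 1 <= m%:R :> R ->
  integral_polytope n (hadamard_polytope H c m n) /\
  normal_polytope n (hadamard_polytope H c m n).
Proof.
move=> N8 Hhad d n0 on om nm _ m_ge.
have m0 : (0 < m)%N by apply: leq_trans nm.
have I3 : (2 < #|'I_N|)%N by rewrite card_ord (leq_trans _ N8).
have oddZ (k : nat) : odd k -> ~~ (2 %| k%:Z)%Z by clear; lia.
have rows := dot_minus_rows c Hhad.
have [off [off2 off_par]] := offsets_exist rows I3 (oddZ n on) (oddZ m om).
have m_geZ : (#|'I_d|%:Z - 3) * n%:Z + 2 * #|'I_d|%:Z - 2 <= 2 * m%:Z.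
  rewrite card_ord -(ler_int R) rmorphB rmorphD !rmorphM rmorphB /= -!pmulrn.
  lra.
have round (y : 'I_d -> R) : (forall j, - n%:Z%:~R <= y j <= 0) ->
    (forall i, 0 <= (off i)%:~R + sdot (minus_at H c i) y) ->
    exists z, (forall j, rounds (z j) (y j)) /\
      forall i, good_row (minus_at H c) off y z i.
  move=> ybox yrow; apply: (rounding_exists off_par yrow c).
  exact: at_most_three_cuts rows R off m%:Z n%:Z y off2 ybox m_geZ.
split; first exact: vertices_in_lattice Hhad m0 off off2 round.
exact: lattice_points_decompose Hhad m0 off off2 round.
Qed.
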